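(* Let $(A,\cdot,\{\cdot,\cdot\},\alpha_1,\alpha_2)$ be a noncommutative BiHom-Poisson algebra and let $(l,r,\rho,\beta_1,\beta_2,V)$ be a representation of it, where $\alpha_1$ and $\beta_2$ are bijective. Define on $A\oplus V$, for $x_1,x_2\in A$ and $v_1,v_2\in V$, $$(x_1+v_1)\cdot'(x_2+v_2):=x_1\cdot x_2+l(x_1)v_2+r(x_2)v_1,$$ $$\{x_1+v_1,x_2+v_2\}':=\{x_1,x_2\}+\rho(x_1)v_2-\rho(\alpha_1^{-1}\alpha_2(x_2))\beta_1\beta_2^{-1}(v_1),$$ $$(\alpha_i+\beta_i)(x_1+v_1):=\alpha_i(x_1)+\beta_i(v_1)\quad(i=1,2).$$ Then $(A\oplus V,\cdot',\{\cdot,\cdot\}',\alpha_1+\beta_1,\alpha_2+\beta_2)$ is a noncommutative BiHom-Poisson algebra.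
   Context: All vector spaces are over a field $\mathbb{K}$ of characteristic different from $2$; $gl(V)$ denotes the space of linear endomorphisms of $V$. A BiHom-associative algebra $(A,\cdot,\alpha_1,\alpha_2)$ is a vector space $A$ with a bilinear product $\cdot$ and commuting linear maps $\alpha_1,\alpha_2:A\to A$ such that $\alpha_i(x\cdot y)=\alpha_i(x)\cdot\alpha_i(y)$ ($i=1,2$) and $\alpha_1(x)\cdot(y\cdot z)=(x\cdot y)\cdot\alpha_2(z)$ for all $x,y,z$. A BiHom-Lie algebra $(A,\{\cdot,\cdot\},\alpha_1,\alpha_2)$ is a vector space with a bilinear bracket and commuting linear maps $\alpha_1,\alpha_2$ such that for all $x,y,z$: $\alpha_i(\{x,y\})=\{\alpha_i(x),\alpha_i(y)\}$ ($i=1,2$); $\{\alpha_2(x),\alpha_1(y)\}=-\{\alpha_2(y),\alpha_1(x)\}$; $\{\alpha_2^2(x),\{\alpha_2(y),\alpha_1(z)\}\}+\{\alpha_2^2(z),\{\alpha_2(x),\alpha_1(y)\}\}+\{\alpha_2^2(y),\{\alpha_2(z),\alpha_1(x)\}\}=0$. A noncommutative BiHom-Poisson algebra is $(A,\cdot,\{\cdot,\cdot\},\alpha_1,\alpha_2)$ such that $(A,\cdot,\alpha_1,\alpha_2)$ is a BiHom-associative algebra, $(A,\{\cdot,\cdot\},\alpha_1,\alpha_2)$ is a BiHom-Lie algebra, and $\{\alpha_1\alpha_2(x),y\cdot z\}=\{\alpha_2(x),y\}\cdot\alpha_2(z)+\alpha_2(y)\cdot\{\alpha_1(x),z\}$ for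 all $x,y,z\in A$. A representation of such an algebra is $(l,r,\rho,\beta_1,\beta_2,V)$ where $V$ is a vector space, $\beta_1,\beta_2:V\to V$ are commuting linear maps, and $l,r,\rho:A\to gl(V)$ are linear, such that for all $x,y\in A$, $v\in V$: (1) (bimodule of the BiHom-associative algebra) $l(x\cdot y)\beta_2(v)=l(\alpha_1(x))l(y)v$; $r(x\cdot y)\beta_1(v)=r(\alpha_2(y))r(x)v$; $l(\alpha_1(x))r(y)v=r(\alpha_2(y))l(x)v$; $\beta_i(l(x)v)=l(\alpha_i(x))\beta_i(v)$ and $\beta_i(r(x)v)=r(\alpha_i(x))\beta_i(v)$ for $i=1,2$; (2) (representation of the BiHom-Lie algebra) $\rho(\{\alpha_2(x),y\})\beta_2(v)=\rho(\alpha_1\alpha_2(x))\rho(y)v-\rho(\alpha_2(y))\rho(\alpha_1(x))v$; $\beta_i(\rho(x)v)=\rho(\alpha_i(x))\beta_i(v)$ for $i=1,2$; (3) $l(\{\alpha_2(x),y\})\beta_2(v)=\rho(\alpha_1\alpha_2(x))l(y)v-l(\alpha_2(y))\rho(\alpha_1(x))v$; $r(\{\alpha_1(x),y\})\beta_2(v)=\rho(\alpha_1\alpha_2(x))r(y)v-r(\alpha_2(y))\rho(\alpha_2(x))v$; $\rho(x\cdot y)\beta_1\beta_2(v)=l(\alpha_1(x))\rho(y)\beta_1(v)+r(\alpha_1(y))\rho(x)\beta_2(v)$. *)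

(* Defs.v *)
From mathcomp Require Import all_boot all_order all_algebra.
Set Implicit Arguments.
Unset Strict Implicit.
Unset Printing Implicit Defensive.
Import GRing.Theory.
Local Open Scope ring_scope.

(* The carriers are vector spaces of arbitrary, possibly infinite dimension. *)

Notation bilinear_map f := (bilinear_for *:%R *:%R f).

Section Algebras.
Variables (K : fieldType) (A : lmodType K).
Implicit Types (mul br : A -> A -> A) (alpha : A -> A).

Record bihom_associative mul alpha1 alpha2 : Prop := {
  bha_bilinear : bilinear_map mul;
  bha_linear1 : linear alpha1;
  bha_linear2 : linear alpha2;
  bha_comm : forall x, alpha1 (alpha2 x) = alpha2 (alpha1 x);
  bha_morph1 : forall x y, alpha1 (mul x y) = mul (alpha1 x) (alpha1 y);
  bha_morph2 : forall x y, alpha2 (mul x y) = mul (alpha2 x) (alpha2 y);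
  bha_assoc : forall x y z,
    mul (alpha1 x) (mul y z) = mul (mul x y) (alpha2 z)
}.

Record bihom_lie br alpha1 alpha2 : Prop := {
  bhl_bilinear : bilinear_map br;
  bhl_linear1 : linear alpha1;
  bhl_linear2 : linear alpha2;
  bhl_comm : forall x, alpha1 (alpha2 x) = alpha2 (alpha1 x);
  bhl_morph1 : forall x y, alpha1 (br x y) = br (alpha1 x) (alpha1 y);
  bhl_morph2 : forall x y, alpha2 (br x y) = br (alpha2 x) (alpha2 y);
  bhl_skew : forall x y,
    br (alpha2 x) (alpha1 y) = - br (alpha2 y) (alpha1 x);
  bhl_jacobi : forall x y z,
      br (alpha2 (alpha2 x)) (br (alpha2 y) (alpha1 z))
    + br (alpha2 (alpha2 z)) (br (alpha2 x) (alpha1 y))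
    + br (alpha2 (alpha2 y)) (br (alpha2 z) (alpha1 x)) = 0
}.

Record nc_bihom_poisson mul br alpha1 alpha2 : Prop := {
  bhp_assoc : bihom_associative mul alpha1 alpha2;
  bhp_lie : bihom_lie br alpha1 alpha2;
  bhp_leibniz : forall x y z,
    br (alpha1 (alpha2 x)) (mul y z)
    = mul (br (alpha2 x) y) (alpha2 z) + mul (alpha2 y) (br (alpha1 x) z)
}.

End Algebras.

(* A linear map A -> gl(V) is encoded by its uncurried form A -> V -> V, which
   is bilinear. *)
Section Representations.
Variables (K : fieldType) (A V : lmodType K).
Implicit Types (mul br : A -> A -> A) (alpha : A -> A).
Implicit Types (l r rho : A -> V -> V) (beta : V -> V).

Record bihom_bimodule mul alpha1 alpha2 l r beta1 beta2 : Prop := {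
  bhm_bilinear_l : bilinear_map l;
  bhm_bilinear_r : bilinear_map r;
  bhm_linear1 : linear beta1;
  bhm_linear2 : linear beta2;
  bhm_comm : forall v, beta1 (beta2 v) = beta2 (beta1 v);
  bhm_l_mul : forall x y v, l (mul x y) (beta2 v) = l (alpha1 x) (l y v);
  bhm_r_mul : forall x y v, r (mul x y) (beta1 v) = r (alpha2 y) (r x v);
  bhm_lr : forall x y v, l (alpha1 x) (r y v) = r (alpha2 y) (l x v);
  bhm_l_beta1 : forall x v, beta1 (l x v) = l (alpha1 x) (beta1 v);
  bhm_l_beta2 : forall x v, beta2 (l x v) = l (alpha2 x) (beta2 v);
  bhm_r_beta1 : forall x v, beta1 (r x v) = r (alpha1 x) (beta1 v);
  bhm_r_beta2 : forall x v, beta2 (r x v) = r (alpha2 x) (beta2 v)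
}.

Record bihom_lie_rep br alpha1 alpha2 rho beta1 beta2 : Prop := {
  bhr_bilinear : bilinear_map rho;
  bhr_linear1 : linear beta1;
  bhr_linear2 : linear beta2;
  bhr_comm : forall v, beta1 (beta2 v) = beta2 (beta1 v);
  bhr_br : forall x y v,
    rho (br (alpha2 x) y) (beta2 v)
    = rho (alpha1 (alpha2 x)) (rho y v) - rho (alpha2 y) (rho (alpha1 x) v);
  bhr_beta1 : forall x v, beta1 (rho x v) = rho (alpha1 x) (beta1 v);
  bhr_beta2 : forall x v, beta2 (rho x v) = rho (alpha2 x) (beta2 v)
}.

Record nc_bihom_poisson_rep mul br alpha1 alpha2 l r rho beta1 beta2 : Prop := {
  bhpr_bimodule : bihom_bimodule mul alpha1 alpha2 l r beta1 beta2;
  bhpr_lie_rep : bihom_lie_rep br alpha1 alpha2 rho beta1 beta2;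
  bhpr_l : forall x y v,
    l (br (alpha2 x) y) (beta2 v)
    = rho (alpha1 (alpha2 x)) (l y v) - l (alpha2 y) (rho (alpha1 x) v);
  bhpr_r : forall x y v,
    r (br (alpha1 x) y) (beta2 v)
    = rho (alpha1 (alpha2 x)) (r y v) - r (alpha2 y) (rho (alpha2 x) v);
  bhpr_rho : forall x y v,
    rho (mul x y) (beta1 (beta2 v))
    = l (alpha1 x) (rho y (beta1 v)) + r (alpha1 y) (rho x (beta2 v))
}.

(* A (+) V is the product lmodType A * V; the pair (x, v) stands for x + v. *)

Definition sd_mul mul l r (p q : A * V) : A * V :=
  (mul p.1 q.1, l p.1 q.2 + r q.1 p.2).

(* ialpha1 and ibeta2 stand for the inverses of alpha1 and beta2. *)
Definition sd_br br (ialpha1 alpha2 : A -> A) rho (beta1 ibeta2 : V -> V)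
    (p q : A * V) : A * V :=
  (br p.1 q.1, rho p.1 q.2 - rho (ialpha1 (alpha2 q.1)) (beta1 (ibeta2 p.2))).

Definition sd_map (alpha : A -> A) (beta : V -> V) (p : A * V) : A * V :=
  (alpha p.1, beta p.2).

End Representations.

(* Main.v *)
(* The A-components of the axioms are those of A, and the V-components hold
   separately in each vector argument.  The one nontrivial point is the
   argument acted on through the twist x |-> alpha1^-1 alpha2 x: since alpha1^-1
   commutes with alpha2 and with both products, the representation axioms can be
   applied at alpha1^-1 alpha2 x and beta2^-1 v, after which the inverses
   cancel. *)

Require Import Defs.
From mathcomp Require Import all_boot all_order all_algebra.
Set Implicit Arguments.
Unset Strict Implicit.
Unset Printing Implicit Defensive.
Import GRing.Theory.
Local Open Scope ring_scope.

Lemma cancel_linear (K : fieldType) (U V : lmodType K) (f : U -> V) g :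
  cancel f g -> cancel g f -> linear f -> linear g.
Proof. by move=> fK gK fL a u v; rewrite -{1}[u]gK -{1}[v]gK -fL fK. Qed.

Lemma cancel_comm (T : Type) (f g h : T -> T) :
  cancel f g -> cancel g f ->
  (forall x, f (h x) = h (f x)) -> forall x, g (h x) = h (g x).
Proof. by move=> fK gK fh x; rewrite -{1}(gK x) -fh fK. Qed.

Section SemidirectProduct.
Variables (K : fieldType) (A V : lmodType K).

Lemma sd_map_linear (alpha : A -> A) (beta : V -> V) :
  linear alpha -> linear beta -> linear (sd_map alpha beta).
Proof. by move=> aL bL c [x u] [y v]; rewrite /sd_map /= aL bL. Qed.

Lemma sd_map_comm (alpha1 alpha2 : A -> A) (beta1 beta2 : V -> V) :
  (forall x, alpha1 (alpha2 x) = alpha2 (alpha1 x)) ->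
  (forall v, beta1 (beta2 v) = beta2 (beta1 v)) ->
  forall p, sd_map alpha1 beta1 (sd_map alpha2 beta2 p)
            = sd_map alpha2 beta2 (sd_map alpha1 beta1 p).
Proof. by move=> aC bC [x u]; rewrite /sd_map /= aC bC. Qed.

(** Only bilinearity of the two actions matters, so the lemma serves the product and the twisted
    bracket alike. *)
Lemma sd_bilinear (mul : A -> A -> A) (l r : A -> V -> V) :
  bilinear_map mul -> bilinear_map l -> bilinear_map r ->
  bilinear_map (sd_mul mul l r).
Proof.
move=> [mulL mulR] [lL lR] [rL rR]; split=> [[z w]|[z w]] a [x u] [y v].
  have /= e1 := mulL z a x y; have /= e2 := lL w a x y.
  have /= e3 := rR z a u v; rewrite /sd_mul /= e1 e2 e3.
  by congr pair; rewrite /= scalerDr addrACA.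
have /= e1 := mulR z a x y; have /= e2 := lR z a u v.
have /= e3 := rL w a x y; rewrite /sd_mul /= e1 e2 e3.
by congr pair; rewrite /= scalerDr addrACA.
Qed.

(** In the associativity law the first vector is governed by [bhm_r_mul], the middle one by [bhm_lr]
    and the last one by [bhm_l_mul]. *)
Lemma sd_bihom_associative (mul : A -> A -> A) alpha1 alpha2
    (l r : A -> V -> V) beta1 beta2 :
  bihom_associative mul alpha1 alpha2 ->
  bihom_bimodule mul alpha1 alpha2 l r beta1 beta2 ->
  bihom_associative (sd_mul mul l r)
    (sd_map alpha1 beta1) (sd_map alpha2 beta2).
Proof.
case=> mulB a1L a2L aC mul1 mul2 mulA.
case=> lB rB b1L b2L bC lM rM lr l1 l2 r1 r2.
have [_ lR] := lB; have [_ rR] := rB.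
split; first exact: sd_bilinear.
- exact: sd_map_linear.
- exact: sd_map_linear.
- exact: sd_map_comm.
- move=> [x u] [y v].
  by rewrite /sd_map /sd_mul /= mul1 (GRing.semilinear_linear b1L).2 l1 r1.
- move=> [x u] [y v].
  by rewrite /sd_map /sd_mul /= mul2 (GRing.semilinear_linear b2L).2 l2 r2.
move=> [x u] [y v] [z w]; rewrite /sd_map /sd_mul /= mulA lM rM.
rewrite (GRing.semilinear_linear (lR _)).2.
by rewrite (GRing.semilinear_linear (rR _)).2 lr addrA.
Qed.

Lemma sd_bihom_lie (br : A -> A -> A) alpha1 alpha2 ialpha1
    (rho : A -> V -> V) beta1 beta2 ibeta2 :
  bihom_lie br alpha1 alpha2 ->
  bihom_lie_rep br alpha1 alpha2 rho beta1 beta2 ->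
  cancel alpha1 ialpha1 -> cancel ialpha1 alpha1 ->
  cancel beta2 ibeta2 -> cancel ibeta2 beta2 ->
  bihom_lie (sd_br br ialpha1 alpha2 rho beta1 ibeta2)
    (sd_map alpha1 beta1) (sd_map alpha2 beta2).
Proof.
case=> brB a1L a2L aC br1 br2 skew jacobi.
case=> rhoB b1L b2L bC rhoM rho1 rho2 a1K ia1K b2K ib2K.
have [rhoL rhoR] := rhoB.
have ia1L := cancel_linear a1K ia1K a1L.
have ib2L := cancel_linear b2K ib2K b2L.
have ia2 := cancel_comm a1K ia1K aC.
have ib1 := cancel_comm b2K ib2K (fun v => esym (bC v)).
have iaM x y : ialpha1 (br x y) = br (ialpha1 x) (ialpha1 y).
  by rewrite -{1}[x]ia1K -{1}[y]ia1K -br1 a1K.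
split.
(* Up to conversion, the twisted bracket is [sd_mul] with left action [rho] and this right action,
   which absorbs the sign. *)
- apply: (@sd_bilinear br rho
    (fun x v => - rho (ialpha1 (alpha2 x)) (beta1 (ibeta2 v)))) => //.
  split=> [v|x] a y z /=.
    have /= rhoLv := rhoL (beta1 (ibeta2 v)).
    by rewrite a2L ia1L rhoLv opprD scalerN.
  by rewrite ib2L b1L rhoR opprD scalerN.
- exact: sd_map_linear.
- exact: sd_map_linear.
- exact: sd_map_comm.
- move=> [x u] [y v].
  rewrite /sd_map /sd_br /= br1 (GRing.zmod_morphism_linear b1L) !rho1.
  by rewrite ia1K -aC a1K ib1.
- move=> [x u] [y v].
  rewrite /sd_map /sd_br /= br2 (GRing.zmod_morphism_linear b2L) !rho2.
  by rewrite !ia2 b2K -bC ib2K.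
(* On these images the twist cancels, leaving [rho (alpha2 x) (beta1 v) - rho (alpha2 y) (beta1 u)],
   visibly antisymmetric. *)
- move=> [x u] [y v]; rewrite /sd_map /sd_br /= skew -!aC !a1K !b2K.
  by congr pair; rewrite opprB.
move=> [x u] [y v] [z w]; rewrite /sd_map /sd_br /=.
congr pair; first exact: jacobi.
(* This is the outer twisted term of each Jacobi summand, expanded by [rhoM] at
   [ialpha1 (alpha2 x1)], [alpha2 x2] and [beta1 v1]. *)
have jacV x1 x2 v1 :
  rho (ialpha1 (alpha2 (br (alpha2 x1) (alpha1 x2))))
      (beta1 (ibeta2 (beta2 (beta2 v1)))) =
  rho (alpha2 (alpha2 x1)) (rho (alpha2 x2) (beta1 v1))
    - rho (alpha2 (alpha2 x2)) (rho (alpha2 x1) (beta1 v1)).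
  by rewrite b2K bC br2 iaM -aC a1K ia2 rhoM -ia2 !ia1K.
rewrite !jacV -!aC !a1K !b2K !(GRing.zmod_morphism_linear (rhoR _)).
rewrite /= !opprB.
(* Each of the three summands contributes four double actions; the twelve terms form six opposite
   pairs, listed positive term first to suit [subrr]. *)
rewrite [LHS](AC (2*2*(2*2)*(2*2)) ((1*8)*(11*2)*(3*6)*(9*4)*(5*12)*(7*10))).
by rewrite /= !subrr !addr0.
Qed.

(** Each axiom linking [rho] to the product settles one vector: [bhpr_rho] that of [p], [bhpr_r]
    that of [q], [bhpr_l] that of [s]. *)
Lemma sd_leibniz (mul br : A -> A -> A) alpha1 alpha2 ialpha1
    (l r rho : A -> V -> V) beta1 beta2 ibeta2 :
  nc_bihom_poisson mul br alpha1 alpha2 ->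
  nc_bihom_poisson_rep mul br alpha1 alpha2 l r rho beta1 beta2 ->
  cancel alpha1 ialpha1 -> cancel ialpha1 alpha1 ->
  cancel beta2 ibeta2 -> cancel ibeta2 beta2 ->
  let sdm := sd_mul mul l r in
  let sdb := sd_br br ialpha1 alpha2 rho beta1 ibeta2 in
  let a1 := sd_map alpha1 beta1 in
  let a2 := sd_map alpha2 beta2 in
  forall p q s, sdb (a1 (a2 p)) (sdm q s)
    = sdm (sdb (a2 p) q) (a2 s) + sdm (a2 q) (sdb (a1 p) s).
Proof.
case=> [[_ _ _ _ mul1 mul2 _] _ leibniz].
case=> [[lB rB _ _ bC _ _ _ _ _ _ _] [rhoB _ _ _ _ _ _] rhol rhor rhoM].
move=> a1K ia1K b2K ib2K.
have [_ lR] := lB; have [_ rR] := rB; have [_ rhoR] := rhoB.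
have iaM x y : ialpha1 (mul x y) = mul (ialpha1 x) (ialpha1 y).
  by rewrite -{1}[x]ia1K -{1}[y]ia1K -mul1 a1K.
move=> sdm sdb a1 a2 [x u] [y v] [z w]; rewrite /sdm /sdb /sd_mul /sd_br /=.
congr pair; first exact: leibniz.
(* The component in u is the compatibility of rho with the product, taken at
   the preimages under alpha1 and beta2 that occur in the twisted bracket. *)
have := rhoM (ialpha1 (alpha2 y)) (ialpha1 (alpha2 z)) (ibeta2 (beta1 u)).
rewrite -iaM -mul2 !ia1K !ib2K => rhoV.
rewrite bC !b2K /= rhoV rhol rhor.
rewrite (GRing.semilinear_linear (rhoR _)).2.
rewrite (GRing.zmod_morphism_linear (rR _)) (GRing.zmod_morphism_linear (lR _)).
(* The pairs [5*2] and [3*8] cancel the subtracted terms of [rhol] and [rhor]; what remains is the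
   left-hand side. *)
rewrite opprD [RHS](AC (2*2*(2*2)) ((1*7)*6*4*(5*2)*(3*8))) /=.
by rewrite !subrr !addr0 addrA.
Qed.

End SemidirectProduct.

Theorem proposition2p16
    (K : fieldType) (charK : 2%N \notin [pchar K])
    (A V : lmodType K)
    (mul br : A -> A -> A) (alpha1 alpha2 : A -> A)
    (l r rho : A -> V -> V) (beta1 beta2 : V -> V)
    (ialpha1 : A -> A) (ibeta2 : V -> V) :
  nc_bihom_poisson mul br alpha1 alpha2 ->
  nc_bihom_poisson_rep mul br alpha1 alpha2 l r rho beta1 beta2 ->
  cancel alpha1 ialpha1 -> cancel ialpha1 alpha1 ->
  cancel beta2 ibeta2 -> cancel ibeta2 beta2 ->
  nc_bihom_poisson
    (sd_mul mul l r)
    (sd_br br ialpha1 alpha2 rho beta1 ibeta2)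
    (sd_map alpha1 beta1) (sd_map alpha2 beta2).
Proof.
move=> poissonA repV a1K ia1K b2K ib2K.
have [assocA lieA _] := poissonA; have [bimodV lie_repV _ _ _] := repV.
split; [exact: sd_bihom_associative | exact: sd_bihom_lie | exact: sd_leibniz].
Qed.
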